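(* (a) For every odd positive integer $p$ and every graph $G$ we have $\chi(G^{[\natural p]})\le\mathrm{wcol}_{2p-1}(G)$. (b) For every even positive integer $p$ and every graph $G$ we have $\chi(G^{[\natural p]})\le\mathrm{wcol}_{2p}(G)\cdot\Delta(G)$.
   Context: All graphs are finite, undirected, simple and without loops. $\chi$ denotes the chromatic number and $\Delta(G)$ the maximum degree. For a graph $G=(V,E)$ and a positive integer $p$, the exact distance-$p$ graph $G^{[\natural p]}$ has vertex set $V$, and $xy$ is an edge if and only if the distance between $x$ and $y$ in $G$ is exactly $p$. Weak colouring numbers: let $L$ be a linear ordering of $V$ and $k$ a positive integer. A vertex $x$ is weakly $k$-accessible from $y$ if $x<_L y$ and there is an $xy$-path of length at most $k$ (length = number of edges) all of whose internal vertices $z$ satisfy $x<_L z$. Let $Q_{L,k}(y)$ be the set of vertices weakly $k$-accessible from $y$, and $\mathrm{wcol}_k(G)=1+\min_L\max_{y\in V}|Q_{L,k}(y)|$, the minimum being over all linear orderings $L$ of $V$.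
   Formalization: In (b) the graph G is assumed to have at least one edge, i.e. Δ(G) ≥ 1, since for a nonempty edgeless graph the bound would read 1 ≤ 1·0. *)

(* Defs.v *)
From mathcomp Require Import all_boot.

Set Implicit Arguments.
Unset Strict Implicit.
Unset Printing Implicit Defensive.

Record sgraph := SGraph {
  svertex :> finType;
  sedge : rel svertex;
  sedge_sym : symmetric sedge;
  sedge_irr : irreflexive sedge }.

Definition max_degree (G : sgraph) : nat :=
  \max_(x : G) #|[set y | sedge x y]|.

(* The vertex sequence of the path is x :: s, so its length (number of edges) *)
(* is size s.                                                                 *)
Definition gpath (G : sgraph) (x y : G) (s : seq G) : bool :=
  [&& path (@sedge G) x s, last x s == y & uniq (x :: s)].

Definition has_path (G : sgraph) (x y : G) (n : nat) : bool :=
  [exists t : n.-tuple G, gpath x y t].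

(* Vertices in different components are at no distance from each other.       *)
Definition at_distance (G : sgraph) (p : nat) : rel G :=
  fun x y => has_path x y p && [forall q : 'I_p, ~~ has_path x y q].

Lemma has_pathP (G : sgraph) (x y : G) n :
  reflect (exists2 s, gpath x y s & size s = n) (has_path x y n).
Proof.
apply: (iffP existsP) => [[t ht]|[s hs sz]].
  by exists t; rewrite ?size_tuple.
have hz : size s == n by apply/eqP.
by exists (Tuple hz).
Qed.

Lemma has_path_sym (G : sgraph) (x y : G) n : has_path x y n = has_path y x n.
Proof.
suff imp (u v : G) : has_path u v n -> has_path v u n.
  by apply/idP/idP; apply: imp.
case/has_pathP => s /and3P[ps /eqP ls us] sz; apply/has_pathP.
exists (rev (belast u s)); last by rewrite size_rev size_belast.
have E : v :: rev (belast u s) = rev (u :: s).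
  by rewrite [u :: s]lastI rev_rcons ls.
rewrite /gpath E rev_uniq us andbT; apply/andP; split.
  by rewrite -ls rev_path (eq_path (e' := @sedge G)) // => a b; apply: sedge_sym.
by case: s {ps us sz E} ls => [<-//|a s] _ /=; rewrite rev_cons last_rcons.
Qed.

Lemma at_distance_sym (G : sgraph) p : symmetric (@at_distance G p).
Proof.
move=> x y; rewrite /at_distance has_path_sym; congr (_ && _).
by apply: eq_forallb => q; rewrite has_path_sym.
Qed.

Lemma at_distance_irr (G : sgraph) p : 0 < p -> irreflexive (@at_distance G p).
Proof.
move=> p_gt0 x; apply/negP => /andP[_ /forallP /(_ (Ordinal p_gt0)) /negP].
by apply; apply/has_pathP; exists [::]; rewrite // /gpath /= eqxx.
Qed.

Definition exact_distance_graph (G : sgraph) (p : nat) (p_gt0 : 0 < p) :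
    sgraph :=
  SGraph (@at_distance_sym G p) (at_distance_irr (G := G) p_gt0).

Definition colourable (G : sgraph) (n : nat) : bool :=
  [exists c : {ffun G -> 'I_n},
    [forall x, forall y, sedge x y ==> (c x != c y)]].

Lemma colourable_ex (G : sgraph) : exists n, colourable G n.
Proof.
exists #|G|; apply/existsP; exists [ffun x => enum_rank x].
apply/forallP => x; apply/forallP => y; apply/implyP => xy.
rewrite !ffunE (inj_eq enum_rank_inj).
by apply: contraTneq xy => ->; rewrite sedge_irr.
Qed.

Definition chromatic_number (G : sgraph) : nat := ex_minn (colourable_ex G).

(* L is read as the strict order: (x, y) \in L means x <_L y.                 *)
Definition linear_order (T : finType) (L : {set T * T}) : bool :=
  [&& [forall x, (x, x) \notin L],
      [forall x, forall y, forall z,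
         ((x, y) \in L) ==> ((y, z) \in L) ==> ((x, z) \in L)] &
      [forall x, forall y, (x != y) ==> ((x, y) \in L) || ((y, x) \in L)]].

(* For a path x :: t of positive length, behead (belast x t) lists its        *)
(* internal vertices; x <_L y excludes length 0.                              *)
Definition weakly_accessible (G : sgraph) (L : {set G * G}) (k : nat)
    (x y : G) : bool :=
  ((x, y) \in L) &&
  [exists n : 'I_k.+1, exists t : n.-tuple G,
     gpath x y t && all (fun z => (x, z) \in L) (behead (belast x t))].

Definition wreach (G : sgraph) (L : {set G * G}) (k : nat) (y : G) : {set G} :=
  [set x | weakly_accessible L k x y].

Definition max_wreach (G : sgraph) (L : {set G * G}) (k : nat) : nat :=
  \max_(y : G) #|wreach L k y|.

Lemma max_wreach_ex (G : sgraph) (k : nat) :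
  exists m, [exists L : {set G * G}, linear_order L && (max_wreach L k == m)].
Proof.
pose L := [set u : G * G | enum_rank u.1 < enum_rank u.2].
exists (max_wreach L k); apply/existsP; exists L; rewrite eqxx andbT.
apply/and3P; split; apply/forallP => x; first by rewrite inE ltnn.
  apply/forallP => y; apply/forallP => z; rewrite !inE /=.
  by apply/implyP => xy; apply/implyP; apply: ltn_trans xy.
apply/forallP => y; apply/implyP; rewrite !inE /= -neq_ltn.
by apply: contraNneq => /ord_inj /enum_rank_inj ->.
Qed.

Definition wcol (k : nat) (G : sgraph) : nat := 1 + ex_minn (max_wreach_ex G k).

(* Main.v *)
(* Fix an ordering L that is optimal for the weak colouring number, and let    *)
(* m(x) be the L-least vertex within distance k = p./2 of x.  Along a shortest *)
(* path from x to y of length p, every vertex is within distance k of x or of  *)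
(* y; so going from m(x) to x, to y and then to m(y), one never drops below    *)
(* both m(x) and m(y), and if these differ, the smaller is weakly              *)
(* (2k + p)-accessible from the larger.  Hence a greedy colouring along L,     *)
(* evaluated at m(x), separates x and y unless m(x) = m(y).  For odd p this    *)
(* coincidence would give d(x, y) <= 2k < p.  For even p it forces x and y to  *)
(* be at distance exactly k from m(x), through distinct neighbours of m(x),    *)
(* which a second colour from a set of Delta(G) colours records.               *)

Require Import Defs.
From mathcomp Require Import all_boot zify.

Set Implicit Arguments.
Unset Strict Implicit.
Unset Printing Implicit Defensive.

(** Colour by increasing [r]: when [y] is reached, [Q y] is already coloured with at most [m] of the
    [m.+1] colours. Vertices of equal rank are treated together, as neither lies in the [Q] of the
    other. *)
Lemma greedy_colouring (T : finType) (r : T -> nat) (Q : T -> {set T}) m :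
  (forall x y, x \in Q y -> r x < r y) -> (forall y, #|Q y| <= m) ->
  exists c : T -> 'I_m.+1, forall x y, x \in Q y -> c x != c y.
Proof.
move=> rQ cardQ.
suff [c cP] : exists c : T -> 'I_m.+1,
    forall x y, r y < \max_z (r z).+1 -> x \in Q y -> c x != c y.
  by exists c => x y; apply: cP; apply: (leq_bigmax (F := fun z => (r z).+1)).
elim: (\max_z _) => [|n [c cP]]; first by exists (fun=> ord0).
pose free y := [pick i | i \notin c @: Q y].
(* Stage [n] recolours exactly the vertices of rank [n]; for them the default [ord0] never arises,
   because [c @: Q y] cannot exhaust the colours. *)
exists (fun y => if r y == n then odflt ord0 (free y) else c y) => x y.
rewrite ltnS leq_eqVlt => /orP[/eqP ry|ryn] xQ; have := rQ _ _ xQ.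
  rewrite ry eqxx => ltxn; rewrite (ltn_eqF ltxn) /free.
  case: pickP => [i|noi] /=; first by apply: contraNneq => <-; rewrite imset_f.
  have : #|'I_m.+1| <= #|c @: Q y|.
    by apply/subset_leq_card/subsetP => i _; have := noi i; case: (i \in _).
  by rewrite card_ord => /leq_trans/(_ (leq_imset_card _ _)); rewrite ltnNge cardQ.
move=> ltxy; rewrite (ltn_eqF ryn) (ltn_eqF (ltn_trans ltxy ryn)).
exact: cP.
Qed.

(** The rank counts the predecessors, so that [L]-least vertices can be found by minimising a
    natural number. *)
Lemma linear_order_rank (T : finType) (L : {set T * T}) : linear_order L ->
  exists2 r : T -> nat, injective r & forall x y, ((x, y) \in L) = (r x < r y).
Proof.
case/and3P => /forallP Lirr /forallP Ltr /forallP Ltot.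
have trL x y z : (x, y) \in L -> (y, z) \in L -> (x, z) \in L.
  by have /forallP/(_ y)/forallP/(_ z)/implyP h := Ltr x => /h/implyP.
pose r (y : T) := #|[set x | (x, y) \in L]|.
have rL x y : (x, y) \in L -> r x < r y.
  move=> xy; apply/proper_card/properP; split.
    by apply/subsetP => z; rewrite !inE => /trL; apply.
  by exists x; rewrite inE.
have Lneq x y : x != y -> ((x, y) \in L) || ((y, x) \in L).
  by have /forallP/(_ y)/implyP := Ltot x.
exists r => [x y rxy | x y].
  by apply/eqP/negPn/negP => /Lneq/orP[] /rL; rewrite rxy ltnn.
apply/idP/idP => [/rL //|rxy].
have /Lneq/orP[//|/rL] : x != y by apply: contraTneq rxy => ->; rewrite ltnn.
by rewrite ltnNge ltnW.
Qed.

Lemma chromatic_number_le (G : sgraph) (T : finType) (c : G -> T) :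
  (forall x y, sedge x y -> c x != c y) -> chromatic_number G <= #|T|.
Proof.
move=> cP; rewrite /chromatic_number; case: ex_minnP => n _; apply.
apply/existsP; exists [ffun x => enum_rank (c x)].
apply/forallP => x; apply/forallP => y; apply/implyP => /cP.
by rewrite !ffunE (inj_eq enum_rank_inj).
Qed.

Section Walks.

Variable G : sgraph.
Implicit Types (x y z : G) (L : {set G * G}).

Definition walk x y (s : seq G) : Prop := path (@sedge G) x s /\ last x s = y.

Definition within n x y : bool := [exists q : 'I_n.+1, has_path x y q].

(** Repeated vertices can be cut out of a walk, so distances may be bounded with walks, which
    concatenate freely. *)
Lemma withinP n x y :
  reflect (exists2 s, walk x y s & size s <= n) (within n x y).
Proof.
apply: (iffP existsP) => [[q /has_pathP[s /and3P[ps /eqP ls _] sz]]|].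
  by exists s => //; rewrite sz -ltnS.
case=> s [ps <-]; case/shortenP: ps => s' ps' us' subs sz.
have sz' : size s' < n.+1.
  by rewrite ltnS (leq_trans _ sz) // uniq_leq_size //; case/andP: us'.
by exists (Ordinal sz'); apply/has_pathP; exists s'; rewrite // /gpath ps' eqxx.
Qed.

Lemma within_sym n x y : within n x y = within n y x.
Proof. by apply: eq_existsb => q; rewrite has_path_sym. Qed.

Lemma walk_cat x y z s t : walk x y s -> walk y z t -> walk x z (s ++ t).
Proof.
by move=> [ps ls] [pt lt]; rewrite /walk cat_path last_cat ls ps pt.
Qed.

Lemma within_trans m n x y z :
  within m x y -> within n y z -> within (m + n) x z.
Proof.
move=> /withinP[s ws szs] /withinP[t wt szt]; apply/withinP.
by exists (s ++ t); [apply: walk_cat wt | rewrite size_cat leq_add].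
Qed.

Lemma within_leq m n x y : m <= n -> within m x y -> within n x y.
Proof.
by move=> mn /withinP[s ws sz]; apply/withinP; exists s; rewrite ?(leq_trans sz).
Qed.

Lemma within_refl n x : within n x x.
Proof. by apply/withinP; exists [::]. Qed.

Lemma walk_within x y s z : walk x y s -> z \in x :: s ->
  exists2 i, i <= size s & within i x z && within (size s - i) z y.
Proof.
move=> [ps ls] zs; case/splitPl: zs ps ls => s1 s2 l1.
rewrite cat_path last_cat l1 => /andP[p1 p2] l2.
exists (size s1); rewrite size_cat ?leq_addr // addKn.
by apply/andP; split; apply/withinP; [exists s1 | exists s2].
Qed.

Lemma at_distance_within p x y : at_distance p x y -> within p x y.
Proof. by case/andP => xy _; apply/existsP; exists ord_max. Qed.

Lemma at_distance_leq p n x y : at_distance p x y -> within n x y -> p <= n.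
Proof.
case/andP => _ /forallP noq /existsP[q xy]; rewrite leqNgt; apply/negP => np.
by have /negP := noq (Ordinal (leq_trans (ltn_ord q) np)).
Qed.

(** Shortening keeps only vertices of the walk, and the resulting path never returns to [x]; hence
    the walk itself may revisit [x]. *)
Lemma walk_accessible L k x y s : walk x y s -> size s <= k ->
  (x, y) \in L -> {in s, forall z, z != x -> (x, z) \in L} ->
  weakly_accessible L k x y.
Proof.
move=> [ps <-] sz; rewrite /weakly_accessible.
case/shortenP: ps => t pt ut subt -> sL /=.
have szt : size t < k.+1.
  by rewrite ltnS (leq_trans _ sz) // uniq_leq_size //; case/andP: ut.
apply/existsP; exists (Ordinal szt); apply/existsP; exists (in_tuple t).
rewrite /gpath [tval _]/= pt eqxx ut /=; have /andP[xt _] := ut.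
case: t {pt ut szt} subt xt => //= a t subt xt.
apply/allP => z /mem_belast zt; apply: sL; first exact: subt.
by apply: contraNneq xt => <-.
Qed.

Lemma least_vertex_accessible (L : {set G * G}) (r : G -> nat) (m : G -> G)
    k p x y :
  injective r -> (forall x y, ((x, y) \in L) = (r x < r y)) ->
  (forall x, within k x (m x)) -> (forall x z, within k x z -> r (m x) <= r z) ->
  p <= k.*2.+1 -> within p x y -> r (m x) < r (m y) ->
  weakly_accessible L (k.*2 + p) (m x) (m y).
Proof.
move=> rI rL mk mmin pk /withinP[s ws szs] rxy.
have [+ /withinP[u wu szu]] := (mk x, mk y).
rewrite within_sym => /withinP[t wt szt].
apply: (walk_accessible (s := t ++ s ++ u)); rewrite ?rL //.
- exact: walk_cat wt (walk_cat ws wu).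
- by rewrite !size_cat; lia.
move=> z zs zx; rewrite rL ltn_neqAle (inj_eq rI) eq_sym zx /=.
suff /orP[/mmin //|/mmin] : within k x z || within k y z.
  by apply: leq_trans; apply: ltnW.
move: zs; rewrite !mem_cat => /or3P[zt|zs|zu].
- have [|i ik /andP[_]] := walk_within (z := z) wt.
    by rewrite inE zt orbT.
  by rewrite within_sym => /within_leq->//; lia.
- have [|i ik /andP[xz]] := walk_within (z := z) ws.
    by rewrite inE zs orbT.
  (* A vertex more than [k] steps from [x] has at most [p - k.+1 <= k] steps left to [y]. *)
  have [ki|ki] := leqP i k; first by rewrite (within_leq ki xz).
  by rewrite within_sym => /(@within_leq _ k)->; rewrite ?orbT //; lia.
have [|i ik /andP[yz _]] := walk_within (z := z) wu.
  by rewrite inE zu orbT.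
by rewrite (within_leq _ yz) ?orbT //; lia.
Qed.

(** The common core of both parities, applied with [p = k.*2.+1] and [p = k.*2]; [c x] is the greedy
    colour of [m x]. *)
Lemma wcol_colouring k p : p <= k.*2.+1 ->
  exists (m : G -> G) (c : G -> 'I_(wcol (k.*2 + p) G)),
    (forall x, within k x (m x)) /\
    (forall x y, within p x y -> m x != m y -> c x != c y).
Proof.
move=> pk; rewrite /wcol; case: ex_minnP => n /existsP[L /andP[Llin /eqP Ln]] _.
have [r rI rL] := linear_order_rank Llin.
have [||c cP] := @greedy_colouring G r (wreach L (k.*2 + p)) n.
- by move=> x y; rewrite inE => /andP[]; rewrite rL.
- by move=> y; rewrite -Ln (leq_bigmax (F := fun y => #|wreach L _ y|)).
pose m x := [arg min_(z < x | within k x z) r z].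
have mk x : within k x (m x).
  by rewrite /m; case: arg_minnP => //; apply: within_refl.
have mmin x z : within k x z -> r (m x) <= r z.
  by rewrite /m; case: arg_minnP => [|i _]; [apply: within_refl | apply].
exists m, (c \o m); split=> // x y xy mxy /=.
have acc := least_vertex_accessible rI rL mk mmin pk.
case: (ltngtP (r (m x)) (r (m y))) => [lt|lt|/rI eq].
- by apply: cP; rewrite inE acc.
- by rewrite eq_sym; apply: cP; rewrite inE acc // within_sym.
- by rewrite eq eqxx in mxy.
Qed.

Lemma neighbour_colouring : 0 < max_degree G ->
  exists e : G -> G -> 'I_(max_degree G), forall v,
    {in [pred w | sedge v w] &, injective (e v)}.
Proof.
move=> D_gt0; pose N v := [set w : G | sedge v w].
(* Neighbours of [v] are numbered by their position among them; the default of [insubd] is reached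
   only off the neighbourhood. *)
exists (fun v w => insubd (Ordinal D_gt0) (index w (enum (N v)))) => v w w'.
rewrite !inE => vw vw' /(congr1 val).
have idx u : sedge v u -> index u (enum (N v)) < max_degree G.
  move=> vu; apply: (leq_trans (n := #|N v|)).
    by rewrite cardE index_mem mem_enum inE.
  exact: (leq_bigmax (F := fun v => #|N v|)).
rewrite !insubdK ?[_ \in _]idx // => /(congr1 (nth v (enum (N v)))).
by rewrite !nth_index // mem_enum inE.
Qed.

End Walks.

Lemma chromatic_exact_distance_odd p (p_gt0 : 0 < p) (G : sgraph) : odd p ->
  chromatic_number (exact_distance_graph G p_gt0) <= wcol (2 * p - 1) G.
Proof.
move=> p_odd; have pE : p = p./2.*2.+1 by rewrite -[LHS]odd_double_half p_odd.
have [|m [c [mk cP]]] := @wcol_colouring G p./2 p; first by rewrite -pE.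
have -> : 2 * p - 1 = p./2.*2 + p by lia.
rewrite -[leqRHS]card_ord; apply: (@chromatic_number_le (exact_distance_graph G p_gt0) _ c) => x y xy.
apply: cP; first exact: at_distance_within.
apply/eqP => mxy; have := within_trans (mk x); rewrite mxy => /(_ p./2 y).
rewrite within_sym => /(_ (mk y))/(at_distance_leq xy).
by lia.
Qed.

Lemma chromatic_exact_distance_even p (p_gt0 : 0 < p) (G : sgraph) :
  ~~ odd p -> 0 < max_degree G ->
  chromatic_number (exact_distance_graph G p_gt0)
    <= wcol (2 * p) G * max_degree G.
Proof.
move=> p_even D_gt0; set k := p./2.
have pE : p = k.*2 by rewrite -[LHS]odd_double_half (negPf p_even).
have [|m [c [mk cP]]] := @wcol_colouring G k p; first by rewrite -pE.
have -> : 2 * p = k.*2 + p by lia.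
have [e eP] := neighbour_colouring D_gt0.
(* [w x] is to be the vertex after [m x] on a walk of length at most [k] to [x]; it exists unless
   [x] is [m x]. *)
pose step x w := sedge (m x) w && within k.-1 w x.
pose w x := odflt x [pick w | step x w].
have wP x : x != m x -> step x (w x).
  move=> xm; rewrite /w; case: pickP => //= now; case/eqP: xm.
  have := mk x; rewrite within_sym => /withinP[[|v s] [/= ps ls] sz] //.
  have /andP[mv vs] := ps; have /negbT/negP[] := now v; rewrite /step mv /=.
  by apply/withinP; exists s => //; lia.
rewrite -[wcol _ G]card_ord -[max_degree G]card_ord -card_prod.
pose f x := (c x, e (m x) (w x)).
apply: (@chromatic_number_le (exact_distance_graph G p_gt0) _ f) => x y xy.
rewrite xpair_eqE negb_and; have [mxy|/cP->//] := eqVneq (m x) (m y); last first.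
  exact: at_distance_within.
apply/orP; right.
(* If [x] were [m x], which is also [m y], then [y] would be within [k < p] of [x]. *)
have xm : x != m x.
  apply: contraTneq (mk y) => xm; rewrite -mxy -xm within_sym.
  by apply/negP => /(at_distance_leq xy); lia.
have ym : y != m y.
  apply: contraTneq (mk x) => ym; rewrite mxy -ym.
  by apply/negP => /(at_distance_leq xy); lia.
have /andP[ex wx] := wP _ xm; have /andP[ey wy] := wP _ ym.
apply/eqP; rewrite -mxy => /eP; rewrite !inE mxy -{1}mxy => /(_ ex ey) wxy.
(* A shared neighbour [w x = w y] would put [x] and [y] within [2 * (k - 1) < p]. *)
have := within_trans _ wy; rewrite -wxy => /(_ k.-1 x).
by rewrite within_sym => /(_ wx)/(at_distance_leq xy); lia.
Qed.

Theorem theorem1p5 :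
  (forall (p : nat) (p_gt0 : 0 < p) (G : sgraph), odd p ->
     chromatic_number (exact_distance_graph G p_gt0) <= wcol (2 * p - 1) G)
  /\
  (forall (p : nat) (p_gt0 : 0 < p) (G : sgraph), ~~ odd p ->
     (* the bound fails for nonempty edgeless graphs: it would read 1 <= 1 * 0 *)
     0 < max_degree G ->
     chromatic_number (exact_distance_graph G p_gt0)
       <= wcol (2 * p) G * max_degree G).
Proof.
split; [exact: chromatic_exact_distance_odd|exact: chromatic_exact_distance_even].
Qed.
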